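(* If $0\le a_i\le ka_s$ for all $i\in S_0$ and $(k-\mu_s-1)a_s\le -a_i\le 0$ for all $i\in S_1$, then the inequality $$w\le\sum_{i\in S_0}Z(a_i)x_i+\sum_{i\in S_1}Z(-a_i)(\mu_i-x_i)+\rho_s(k)(x_s-k)+g(ka_s)$$ is facet-defining for $\operatorname{conv}(\mathcal{X})$.
   Context: Let $n\ge 1$, let $f:\mathbb{R}\to\mathbb{R}$ be concave, let $a\in\mathbb{R}^n$ with $a_i\ge 0$ for all $i$, and let $\mu\in\mathbb{Z}^n$ with all $\mu_i\ge 1$. Define $$\mathcal{X}=\{(w,x)\in\mathbb{R}\times\mathbb{Z}^n : w\le f(a^\top x),\ 0\le x_i\le\mu_i\ \text{for } i=1,\dots,n\}.$$ Fix $s\in\{1,\dots,n\}$ with $a_s>0$, disjoint subsets $S_0,S_1$ of $\{1,\dots,n\}\setminus\{s\}$ with $\{s\}\cup S_0\cup S_1=\{1,\dots,n\}$, and an integer $k\in\{1,\dots,\mu_s\}$. Define $g(z)=f\big(z+\sum_{i\in S_1}\mu_i a_i\big)$, $\rho_s(k)=g(ka_s)-g((k-1)a_s)$, and, for $\delta\in\mathbb{R}$, $$Z(\delta)=\max_{x\in\mathbb{Z}}\ \big[g(\delta+a_s x)-\rho_s(k)(x-k)-g(ka_s)\big],$$ which has the closed form $Z(\delta)=g(\delta+(k-\ell-1)a_s)+(\ell+1)\rho_s(k)-g(ka_s)$ if $\ell a_s\le\delta<(\ell+1)a_s$, $\ell\in\mathbb{Z}$. A linear inequality is facet-defining for a polyhedron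 $P$ if it is valid for $P$ and the set of points of $P$ satisfying it with equality is a face of dimension $\dim P-1$. *)

(* Defs.v *)
From mathcomp Require Import all_boot all_order all_algebra.
From mathcomp Require Import all_classical all_reals all_analysis.
Set Implicit Arguments.
Unset Strict Implicit.
Unset Printing Implicit Defensive.
Import Order.TTheory GRing.Theory Num.Theory.
Local Open Scope classical_set_scope.
Local Open Scope ring_scope.

Definition concave_function (R : realType) (f : R -> R) : Prop :=
  convex_function [set: convex_lmodType R^o] (fun x => - f x).

Definition conv_hull (R : realType) (V : lmodType R) (A : set V) : set V :=
  smallest (fun C => @convex_set R V C) A.

Definition affinely_independent (R : realType) (V : lmodType R) (m : nat)
    (p : 'I_m -> V) : Prop :=
  forall c : 'I_m -> R, \sum_i c i = 0 -> \sum_i c i *: p i = 0 ->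
  forall i, c i = 0.

(* The dimension of A is d when d + 1 is the largest number of affinely
   independent points of A; in particular the empty set has dimension -1. *)
Definition has_dim (R : realType) (V : lmodType R) (A : set V) (d : int) :
    Prop :=
  exists m : nat,
    [/\ d = m%:Z - 1,
        exists p : 'I_m -> V, (forall i, A (p i)) /\ affinely_independent p
      & forall (m' : nat) (p : 'I_m' -> V),
          (forall i, A (p i)) -> affinely_independent p -> (m' <= m)%N].

Definition valid_ineq (R : realType) (V : lmodType R) (P : set V)
    (lhs rhs : V -> R) : Prop :=
  forall p, P p -> lhs p <= rhs p.

Definition tight_points (R : realType) (V : lmodType R) (P : set V)
    (lhs rhs : V -> R) : set V :=
  P `&` [set p | lhs p = rhs p].

Definition is_face (R : realType) (V : lmodType R) (P F : set V) : Prop :=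
  exists (c : {scalar V}) (b : R),
    valid_ineq P c (fun=> b) /\ F = tight_points P c (fun=> b).

(* The inequality lhs <= rhs between two affine functions defines a facet.
   Its linearity is not assumed separately: is_face makes the set of tight
   points the intersection of P with a supporting hyperplane (or P itself, or
   the empty set). *)
Definition facet_defining (R : realType) (V : lmodType R) (P : set V)
    (lhs rhs : V -> R) : Prop :=
  [/\ valid_ineq P lhs rhs,
      is_face P (tight_points P lhs rhs)
    & exists d : int, has_dim P d /\ has_dim (tight_points P lhs rhs) (d - 1)].

(* Points (w, x) of R x R^n; R^o makes the first factor, hence the product, a
   vector space over R. *)
Definition wx_space (R : realType) (n : nat) : lmodType R :=
  (R^o * 'rV[R]_n)%type.

Definition calX (R : realType) (n : nat) (f : R -> R) (a : 'rV[R]_n)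
    (mu : 'rV[int]_n) : set (wx_space R n) :=
  [set p : R^o * 'rV[R]_n |
    [/\ forall i : 'I_n, p.2 0 i \is a Num.int,
        p.1 <= f (\sum_(i < n) a 0 i * p.2 0 i)
      & forall i : 'I_n, 0 <= p.2 0 i <= (mu 0 i)%:~R]].

Definition g_of (R : realType) (n : nat) (f : R -> R) (a : 'rV[R]_n)
    (mu : 'rV[int]_n) (S1 : {set 'I_n}) (z : R) : R :=
  f (z + \sum_(i in S1) (mu 0 i)%:~R * a 0 i).

Definition rho_of (R : realType) (g : R -> R) (a_s : R) (k : int) : R :=
  g (k%:~R * a_s) - g ((k - 1)%:~R * a_s).

(* The maximum over the integers x, written as a supremum: it is attained when
   g is concave and 0 < a_s, because the increments of g along steps of length
   a_s are nonincreasing and equal rho_of g a_s k from (k - 1) a_s to k a_s. *)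
Definition Zmax (R : realType) (g : R -> R) (a_s : R) (k : int) (delta : R) :
    R :=
  sup [set g (delta + a_s * x%:~R) - rho_of g a_s k * (x - k)%:~R
           - g (k%:~R * a_s) | x in [set: int]].

(* Main.v *)
From HB Require Import structures.
Require Import Defs.
From mathcomp Require Import all_boot all_order all_algebra.
From mathcomp Require Import all_classical all_reals all_analysis.
From mathcomp Require Import ring lra zify.
Import Order.TTheory GRing.Theory Num.Theory.
Local Open Scope classical_set_scope.
Local Open Scope ring_scope.

(* Write [a] for the a-coefficient of [s]. The increments of the concave
   function g along steps of length [a] decrease, so Z satisfies
   Z (d + a) = Z d + rho_s, and on [0, a] it is the concave function
   d |-> g (d + (k - 1) a) - g ((k - 1) a). Hence Z is subadditive: for r, t in
   [0, a], the points r and t lie between 0 and r + t if r + t <= a, and between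
   r + t - a and a otherwise. Subadditivity, together with
   g (d + a x) <= Z d + rho_s (x - k) + g (k a), gives validity.

   Let v be the point with v_i = mu_i for i in S1 and v_i = 0 elsewhere. The
   inequality is tight at v + k e_s, at v + (k - 1) e_s and, for i <> s, at
   v + e_i + t_i e_s (i in S0) or v - e_i + t_i e_s (i in S1), where t_i
   attains the maximum defining Z (a_i), resp. Z (- a_i); the bounds on a_i are
   what makes 0 <= t_i <= mu_s possible. These n + 1 points are affinely
   independent. *)

(** * Concavity on the line, and division by a step length *)

Lemma concave_four_points {R : realType} {g : R -> R} (p q u v : R) :
  concave_function g -> p <= u -> u <= q -> p + q = u + v -> g p + g q <= g u + g v.
Proof.
move=> cg pu uq pquv.
have [pq|pq] := eqVneq p q.
  have -> : u = p by lra.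
  by have -> : v = q by lra.
have qp_gt0 : 0 < q - p by rewrite subr_gt0 lt_neqAle pq (le_trans pu).
(* With this weight [t], [u = t p + (1 - t) q] and [v = t q + (1 - t) p]; the two concavity
   inequalities add up to the claim. *)
have t0 : 0 <= (q - u) / (q - p) by rewrite divr_ge0 ?(ltW qp_gt0) ?subr_ge0.
have t1 : (q - u) / (q - p) <= 1 by rewrite ler_pdivrMr // mul1r; lra.
have cgE x y : - g ((q - u) / (q - p) * x + (1 - (q - u) / (q - p)) * y) <=
    (q - u) / (q - p) * - g x + (1 - (q - u) / (q - p)) * - g y.
  by have := cg (Itv01 t0 t1) x y; rewrite !inE; apply.
have := lerD (cgE p q) (cgE q p).
set t := (q - u) / (q - p).
have tE : t * (q - p) = q - u by rewrite /t divfK ?gt_eqF.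
have -> : t * p + (1 - t) * q = u by lra.
have -> : t * q + (1 - t) * p = v by lra.
lra.
Qed.

Lemma concave_shift {R : realType} {f : R -> R} (c : R) :
  concave_function f -> concave_function (fun z => f (z + c)).
Proof.
move=> cf t x y _ _.
have := cf t (x + c) (y + c); rewrite !inE => /(_ I I).
congr (- f _ <= _).
rewrite /conv /= !scalerDr addrACA -scalerDl /=.
by congr (_ + _); rewrite addrCA subrr addr0 scale1r.
Qed.

(** Closed cells keep [l < q] at the right end: for [d = q a] the floor of [d / a] would be [q], and
    [q - 1] is taken instead. *)
Lemma int_div_itv {R : realType} {a d : R} {p q : int} :
  0 < a -> p < q -> p%:~R * a <= d <= q%:~R * a ->
  exists l : int, p <= l < q /\ l%:~R * a <= d <= (l + 1)%:~R * a.
Proof.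
move=> a_gt0 pq /andP[pd dq].
have [dqE|dqE] := eqVneq d (q%:~R * a).
  exists (q - 1); split; first by lia.
  by rewrite subrK dqE lexx ler_pM2r // ler_int; lia.
have /andP[fd df] := floor_itv (d / a).
exists (Num.floor (d / a)); split.
  rewrite Num.Theory.floor_ge_int ?ler_pdivlMr // pd /=.
  by rewrite floor_lt_int ltr_pdivrMr // lt_neqAle dqE.
by rewrite -ler_pdivlMr // fd -ler_pdivrMr // ltW.
Qed.

(** * Values, maximizers and subadditivity of Z *)

Section Zmax.
Context {R : realType} {g : R -> R} {a : R} {k : int}.
Hypotheses (cg : concave_function g) (a_gt0 : 0 < a).

(** The translation moves the step of [g] with increment [rho] to [[0, a]]. *)
Let G y := g (y + (k - 1)%:~R * a).
Let rho := rho_of g a k.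

Let G_concave : concave_function G.
Proof. exact: concave_shift. Qed.

Let G_rho : G a = G 0 + rho.
Proof.
rewrite /rho /rho_of /G add0r [RHS]addrC subrK.
by congr g; rewrite rmorphB /=; ring.
Qed.

(** The four-point inequality compares each step of length [a] with the one from [0] to [a]: steps
    further right gain at most [rho], steps further left at least [rho]. *)
Let G_step (r : R) (m : int) : 0 <= r <= a -> G (r + a * m%:~R) - rho * m%:~R <= G r.
Proof.
move=> /andP[r0 ra].
have right n : G (r + a * n%:R) - rho * n%:R <= G r.
  elim: n => [|n IHn]; first by rewrite !mulr0 addr0 subr0.
  have n0 : 0 <= a * n%:R by rewrite mulr_ge0 // ltW.
  have : G 0 + G (r + a * n.+1%:R) <= G (r + a * n%:R) + G a.
    by apply: concave_four_points => //; rewrite -?natr1; lra.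
  have := G_rho; rewrite -natr1; lra.
have left n : G (r - a * n%:R) + rho * n%:R <= G r.
  elim: n => [|n IHn]; first by rewrite !mulr0 subr0 addr0.
  have n0 : 0 <= a * n%:R by rewrite mulr_ge0 // ltW.
  have : G (r - a * n.+1%:R) + G a <= G (r - a * n%:R) + G 0.
    by apply: concave_four_points => //; rewrite -?natr1; lra.
  have := G_rho; rewrite -natr1; lra.
case: m => n; first exact: right.
by rewrite NegzE mulrNz !mulrN opprK; exact: left.
Qed.

(** The index [x] moves the argument of [G] from [r] by [x + l - (k - 1)] steps, so [G_step] bounds
    every term, with equality at [x = k - 1 - l]. The end [r = a] is allowed because
    [G a = G 0 + rho] makes neighbouring cells agree. *)
Lemma Zmax_max (l : int) (r : R) : 0 <= r <= a ->
  Zmax g a k (l%:~R * a + r) = G r - G 0 + l%:~R * rho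
  /\ forall x : int, g (l%:~R * a + r + a * x%:~R) - rho * (x - k)%:~R
       - g (k%:~R * a) <= G r - G 0 + l%:~R * rho.
Proof.
move=> ra.
have gk : g (k%:~R * a) = G 0 + rho.
  by rewrite -G_rho /G; congr g; rewrite rmorphB /=; ring.
have ub (x : int) : g (l%:~R * a + r + a * x%:~R) - rho * (x - k)%:~R
    - g (k%:~R * a) <= G r - G 0 + l%:~R * rho.
  have := G_step r (x + l - (k - 1)) ra.
  rewrite [G (r + _)]/G gk.
  have -> : r + a * (x + l - (k - 1))%:~R + (k - 1)%:~R * a =
     l%:~R * a + r + a * x%:~R by rewrite !(rmorphB, rmorphD) /=; ring.
  rewrite !(rmorphB, rmorphD) /=; lra.
split=> //; apply/le_anti/andP; split.
  by apply: ge_sup => [|_ [x _ <-]]; [exists (g (l%:~R * a + r + a * 0%:~R)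
    - rho * (0 - k)%:~R - g (k%:~R * a)); exists 0 | exact: ub].
apply: ub_le_sup; first by exists (G r - G 0 + l%:~R * rho) => _ [x _ <-].
exists (k - 1 - l) => //; rewrite gk.
have -> : l%:~R * a + r + a * (k - 1 - l)%:~R = r + (k - 1)%:~R * a.
  by rewrite !(rmorphB, rmorphD) /=; ring.
rewrite -/rho -/(G r) !(rmorphB, rmorphD) /=; ring.
Qed.

Let decomp (d : R) : exists l r, 0 <= r < a /\ d = l%:~R * a + r.
Proof.
have /andP[fd df] := floor_itv (d / a).
exists (Num.floor (d / a)), (d - (Num.floor (d / a))%:~R * a); split; last by ring.
move: fd df; rewrite ler_pdivlMr // ltr_pdivrMr // rmorphD /=; lra.
Qed.

Lemma Zmax_ge (d : R) (x : int) :
  g (d + a * x%:~R) - rho * (x - k)%:~R - g (k%:~R * a) <= Zmax g a k d.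
Proof.
have [l [r [/andP[r0 ra] ->]]] := decomp d.
have /(Zmax_max l _)[-> ub] : 0 <= r <= a by rewrite r0 ltW.
exact: ub.
Qed.

(** In the cell [l a <= d <= (l + 1) a] the maximizer is [k - 1 - l], and [k - m - 1 <= l < k] says
    exactly that it lies between [0] and [m]. *)
Lemma Zmax_attained (d : R) (m : int) : 0 < m ->
  (k - m - 1)%:~R * a <= d <= k%:~R * a ->
  exists2 x : int, 0 <= x <= m &
    Zmax g a k d = g (d + a * x%:~R) - rho * (x - k)%:~R - g (k%:~R * a).
Proof.
move=> m_gt0 /(int_div_itv a_gt0)[|l [lk /andP[ld dl]]]; first by lia.
exists (k - 1 - l); first by lia.
have rP : 0 <= d - l%:~R * a <= a by move: dl; rewrite rmorphD /=; lra.
have [+ _] := Zmax_max l _ rP.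
rewrite addrC subrK => ->.
have -> : g (k%:~R * a) = G 0 + rho.
  by rewrite -G_rho /G; congr g; rewrite rmorphB /=; ring.
have -> : d + a * (k - 1 - l)%:~R = d - l%:~R * a + (k - 1)%:~R * a.
  by rewrite !(rmorphB, rmorphD) /=; ring.
rewrite -/(G (d - _)) !(rmorphB, rmorphD) /=; ring.
Qed.

Lemma Zmax0 : Zmax g a k 0 = 0.
Proof.
have r0 : 0 <= (0 : R) <= a by rewrite lexx ltW.
by have [+ _] := Zmax_max 0 _ r0; rewrite !mul0r !addr0 subrr.
Qed.

Lemma Zmax_subadditive (d e : R) :
  Zmax g a k (d + e) <= Zmax g a k d + Zmax g a k e.
Proof.
have [l [r [/andP[r0 ra] ->]]] := decomp d.
have [m [t [/andP[t0 ta] ->]]] := decomp e.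
have /(Zmax_max l _)[-> _] : 0 <= r <= a by lra.
have /(Zmax_max m _)[-> _] : 0 <= t <= a by lra.
have [rta|art] := leP (r + t) a.
  have -> : l%:~R * a + r + (m%:~R * a + t) = (l + m)%:~R * a + (r + t).
    by rewrite rmorphD /=; ring.
  have /(Zmax_max (l + m) _)[-> _] : 0 <= r + t <= a by lra.
  have : G 0 + G (r + t) <= G r + G t by apply: concave_four_points => //; lra.
  rewrite rmorphD /=; lra.
(* A carry: the cell index rises by one, and the extra [rho] is [G a - G 0]. *)
have -> : l%:~R * a + r + (m%:~R * a + t) = (l + m + 1)%:~R * a + (r + t - a).
  by rewrite !rmorphD /=; ring.
have /(Zmax_max (l + m + 1) _)[-> _] : 0 <= r + t - a <= a by lra.
have : G (r + t - a) + G a <= G r + G t by apply: concave_four_points => //; lra.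
have := G_rho; rewrite !rmorphD /=; lra.
Qed.

Lemma Zmax_mulrn (d : R) (m : nat) : Zmax g a k (d * m%:R) <= Zmax g a k d * m%:R.
Proof.
elim: m => [|m IHm]; first by rewrite !mulr0 Zmax0.
rewrite -natr1 !mulrDr !mulr1.
by apply: le_trans (Zmax_subadditive _ _) _; rewrite lerD2r.
Qed.

Lemma Zmax_sum (I : finType) (P : pred I) (d : I -> R) (m : I -> nat) :
  Zmax g a k (\sum_(i | P i) d i * (m i)%:R) <=
  \sum_(i | P i) Zmax g a k (d i) * (m i)%:R.
Proof.
elim/big_ind2: _ => [|x1 x2 y1 y2 le1 le2|i _]; first by rewrite Zmax0.
- by apply: le_trans (Zmax_subadditive _ _) _; apply: lerD.
- exact: Zmax_mulrn.
Qed.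

End Zmax.

(** * An upper bound on the number of affinely independent points *)

Section AffineIndependence.
Context {R : realType} {V : lmodType R}.

(** [T] plays the role of homogeneous coordinates. If [d < m], the matrix of images has a nonzero
    left kernel vector, which is an affine relation between the points. *)
Lemma affinely_independent_leq (m d : nat) (p : 'I_m -> V) (T : V -> 'rV[R]_d) :
  (forall c : 'I_m -> R, \sum_i c i *: T (p i) = 0 ->
     \sum_i c i = 0 /\ \sum_i c i *: p i = 0) ->
  affinely_independent p -> (m <= d)%N.
Proof.
move=> Tp ip; rewrite leqNgt; apply/negP => dm.
pose M := \matrix_(i < m) T (p i).
have : kermx M != 0.
  rewrite kermx_eq0 /row_free neq_ltn.
  by rewrite (leq_ltn_trans (rank_leq_col M) dm).
move=> /rowV0Pn[u uM /eqP]; apply; apply/rowP => i; rewrite mxE.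
have /Tp[c0 cp] : \sum_i u 0 i *: T (p i) = 0.
  move/sub_kermxP: uM; rewrite mulmx_sum_row => uM.
  by rewrite -[RHS]uM; apply: eq_bigr => j _; rewrite rowK.
exact: ip cp i.
Qed.

End AffineIndependence.

(** * Facets of a convex hull from tight points *)

Section Facet.
Context {R : realType} {n : nat}.
Implicit Types (p : wx_space R n) (x : 'rV[R]_n) (X : set (wx_space R n)).

Lemma sum_fst (I : finType) (c : I -> R) (p : I -> wx_space R n) :
  (\sum_i c i *: p i).1 = \sum_i c i * (p i).1.
Proof. by elim/big_ind2: _ => // x1 x2 y1 y2 <- <-. Qed.

Lemma sum_snd (I : finType) (c : I -> R) (p : I -> wx_space R n) :
  (\sum_i c i *: p i).2 = \sum_i c i *: (p i).2.
Proof. by elim/big_ind2: _ => // x1 x2 y1 y2 <- <-. Qed.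

Lemma wx_eq0 p : p.1 = 0 -> p.2 = 0 -> p = 0.
Proof. by case: p => w x /= -> ->. Qed.

Definition dot (u x : 'rV[R]_n) : R := \sum_i u 0 i * x 0 i.

Lemma dotD u x y : dot u (x + y) = dot u x + dot u y.
Proof. by rewrite -big_split; apply: eq_bigr => i _; rewrite mxE mulrDr. Qed.

Lemma dotZ u (c : R) x : dot u (c *: x) = c * dot u x.
Proof. by rewrite mulr_sumr; apply: eq_bigr => i _; rewrite mxE; ring. Qed.

Lemma dot_delta u (i : 'I_n) : dot u (delta_mx 0 i) = u 0 i.
Proof.
rewrite /dot (bigD1 i) //= mxE !eqxx mulr1 big1 ?addr0 // => j /negPf ji.
by rewrite mxE ji andbF mulr0.
Qed.

Lemma dot_sum u (I : finType) (c : I -> R) (x : I -> 'rV[R]_n) :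
  dot u (\sum_i c i *: x i) = \sum_i c i * dot u (x i).
Proof.
elim/big_rec2: _ => [|i y1 y2 _ <-]; last by rewrite dotD dotZ.
by rewrite /dot big1 // => i _; rewrite mxE mulr0.
Qed.

(** Puts the inequality in the form [slack u p <= b], a linear functional against a constant, as
    [is_face] requires. *)
Definition slack (u : 'rV[R]_n) (p : wx_space R n) : R := p.1 - dot u p.2.

Lemma slack_linear u : linear_for *%R (slack u).
Proof. by move=> c p q; rewrite /slack dotD dotZ /=; rewrite /GRing.scale /=; ring. Qed.

Lemma slack_le_convex u (b : R) : @convex_set R _ [set p | slack u p <= b].
Proof.
move=> x y t; rewrite !inE /= => xb yb; rewrite /conv /=.
have -> : slack u (t%:num *: x + (1 - t%:num) *: y)
    = t%:num * slack u x + (1 - t%:num) * slack u y.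
  by rewrite /slack dotD !dotZ /= /GRing.scale /=; ring.
have t0 : 0 <= t%:num by [].
have t1 : t%:num <= 1 by [].
have h1 : t%:num * slack u x <= t%:num * b by exact: ler_wpM2l.
have h2 : (1 - t%:num) * slack u y <= (1 - t%:num) * b.
  by apply: ler_wpM2l => //; rewrite subr_ge0.
lra.
Qed.

(* The point (w0, q ord0) lies strictly below the hyperplane of the tight points
   and makes conv_hull X full-dimensional. *)
Lemma facet_of_tight_points X (u : 'rV[R]_n) (b w0 : R) (q : 'I_n.+1 -> 'rV[R]_n) :
  (forall p, X p -> p.1 <= dot u p.2 + b) ->
  affinely_independent q ->
  (forall i, X (dot u (q i) + b, q i)) ->
  X (w0, q ord0) -> w0 < dot u (q ord0) + b ->
  facet_defining (conv_hull X) (fun p : R^o * 'rV[R]_n => p.1)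
    (fun p : R^o * 'rV[R]_n => dot u p.2 + b).
Proof.
move=> valid_X iq Xq Xw0 w0_lt.
have XP p : X p -> conv_hull X p by move=> Xp C [_]; apply.
have valid_P p : conv_hull X p -> slack u p <= b.
  move=> /(_ [set p | slack u p <= b]); apply; split; first exact: slack_le_convex.
  by move=> r /valid_X /=; rewrite /slack; lra.
have tightE : tight_points (conv_hull X) (fun p : R^o * 'rV[R]_n => p.1)
    (fun p : R^o * 'rV[R]_n => dot u p.2 + b)
  = tight_points (conv_hull X) (slack u) (fun=> b).
  by apply/seteqP; split=> p [Pp /= e]; split=> //=; move: e; rewrite /slack; lra.
split.
- by move=> p /valid_P; rewrite /slack /=; lra.
- pose HB := GRing.isLinear.Build _ _ _ _ (slack u) (slack_linear u).
  pose sl : {scalar wx_space R n} := HB.pack (slack u) HB.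
  by exists sl, b.
(* [has_dim] counts points: [n + 2] for the hull, of dimension [n + 1], and [n + 1] for the face. *)
exists n.+1%:Z; split.
  exists n.+2; split; first by lia.
    pose p (i : 'I_n.+2) : wx_space R n :=
      if unlift ord0 i is Some j then (dot u (q j) + b, q j) else (w0, q ord0).
    exists p; split.
      by move=> i; apply: XP; rewrite /p; case: unlift => [j|//]; exact: Xq.
    move=> c c0 cp.
    (* [slack u - b] vanishes at every point of the relation except the lower one, so the
       coefficient of that point is zero. *)
    have c_0 : c ord0 = 0.
      have := congr1 fst cp; rewrite sum_fst big_ord_recl.
      have := congr1 (dot u \o snd) cp; rewrite /= sum_snd dot_sum big_ord_recl.
      rewrite big_ord_recl in c0.
      rewrite /p unlift_none /=.
      under eq_bigr => i _ do rewrite liftK.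
      under [X in _ + X = 0]eq_bigr => i _ do rewrite liftK /= mulrDr.
      rewrite big_split /= -mulr_suml.
      have -> : dot u 0 = 0 by rewrite /dot big1 // => i _; rewrite mxE mulr0.
      move: c0; set A := \sum_(i < n.+1) c _.
      set B := \sum_(i < n.+1) _ * dot _ _ => e1 e2 e3.
      have /eqP : c ord0 * (w0 - dot u (q ord0) - b) = 0.
        have AE : A = - c ord0 by lra.
        rewrite AE in e3; lra.
      by rewrite mulf_eq0 => /orP[/eqP//|/eqP]; lra.
    have cl : forall j, c (lift ord0 j) = 0.
      apply: iq; first by move: c0; rewrite big_ord_recl c_0 add0r.
      have := congr1 snd cp; rewrite sum_snd big_ord_recl c_0 scale0r add0r.
      by move=> /= e; rewrite -[RHS]e; apply: eq_bigr => i _; rewrite /p liftK.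
    by move=> i; case: (unliftP ord0 i) => [j|] ->.
  (* Homogeneous coordinates [(1, w, x)]. *)
  move=> m p _; apply: (affinely_independent_leq _ (1 + (1 + n)) _
     (fun p => row_mx 1%:M (row_mx (p.1)%:M p.2))).
  move=> c cT.
  have := congr1 (fun A => lsubmx A 0 0) cT.
  have := congr1 (fun A => lsubmx (rsubmx A) 0 0) cT.
  have := congr1 (fun A => rsubmx (rsubmx A)) cT.
  rewrite !linear_sum !summxE /= !linear0 !mxE => e2 e1 e0.
  split.
    by rewrite -[RHS]e0; apply: eq_bigr => i _; rewrite linearZ /= row_mxKl !mxE mulr1.
  apply: wx_eq0.
    rewrite sum_fst -[RHS]e1; apply: eq_bigr => i _.
    by rewrite !linearZ /= row_mxKr row_mxKl !mxE mulr1n.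
  by rewrite sum_snd -[RHS]e2; apply: eq_bigr => i _; rewrite !linearZ /= !row_mxKr.
rewrite tightE; exists n.+1; split; first by lia.
  exists (fun i => (dot u (q i) + b, q i)); split.
    by move=> i; split; [apply: XP; exact: Xq | rewrite /= /slack /=; lra].
  move=> c c0 cq; apply: iq => //.
  by have := congr1 snd cq; rewrite sum_snd.
(* On tight points [w] is an affine function of [x], so the coordinates [(1, x)] suffice. *)
move=> m p pT; apply: (affinely_independent_leq _ (1 + n) _
     (fun p => row_mx 1%:M p.2)).
move=> c cT.
have := congr1 (fun A => lsubmx A 0 0) cT.
have := congr1 (fun A => rsubmx A) cT.
rewrite !linear_sum !summxE /= !linear0 !mxE => e2 e0.
have c0 : \sum_i c i = 0.
  by rewrite -[RHS]e0; apply: eq_bigr => i _; rewrite linearZ /= row_mxKl !mxE mulr1.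
have c2 : \sum_i c i *: (p i).2 = 0.
  by rewrite -[RHS]e2; apply: eq_bigr => i _; rewrite linearZ /= row_mxKr.
split=> //; apply: wx_eq0; rewrite ?sum_snd // sum_fst.
have : \sum_i c i * slack u (p i) = 0.
  under eq_bigr => i _ do have [_ /= ->] := pT i.
  by rewrite -mulr_suml c0 mul0r.
rewrite /slack; under eq_bigr => i _ do rewrite mulrBr.
rewrite sumrB -dot_sum c2.
have -> : dot u 0 = 0 by rewrite /dot big1 // => i _; rewrite mxE mulr0.
by rewrite subr0 => ->.
Qed.

End Facet.

(** * The facet: the tight points, validity and affine independence *)

Theorem corollary3p4 (R : realType) (n : nat) (f : R -> R) (a : 'rV[R]_n)
    (mu : 'rV[int]_n) (s : 'I_n) (S0 S1 : {set 'I_n}) (k : int)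
    (n_ge1 : (1 <= n)%N)
    (f_concave : concave_function f)
    (a_ge0 : forall i : 'I_n, 0 <= a 0 i)
    (mu_ge1 : forall i : 'I_n, 1 <= mu 0 i)
    (as_gt0 : 0 < a 0 s)
    (s_notin_S0 : s \notin S0) (s_notin_S1 : s \notin S1)
    (disjoint_S0S1 : [disjoint S0 & S1]%B)
    (cover : (s |: (S0 :|: S1))%SET = [set: 'I_n]%SET)
    (k_range : 1 <= k <= mu 0 s)
    (hS0 : forall i : 'I_n, i \in S0 -> 0 <= a 0 i <= k%:~R * a 0 s)
    (hS1 : forall i : 'I_n, i \in S1 ->
       (k - mu 0 s - 1)%:~R * a 0 s <= - a 0 i <= 0) :
  let g := g_of f a mu S1 in
  let rho_s := rho_of g (a 0 s) in
  let Z := Zmax g (a 0 s) k in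
  facet_defining (conv_hull (calX f a mu))
    (fun p : R^o * 'rV[R]_n => p.1)
    (fun p : R^o * 'rV[R]_n =>
       \sum_(i in S0) Z (a 0 i) * p.2 0 i
       + \sum_(i in S1) Z (- a 0 i) * ((mu 0 i)%:~R - p.2 0 i)
       + rho_s k * (p.2 0 s - k%:~R) + g (k%:~R * a 0 s)).
Proof.
move=> g rho Z.
have cg : concave_function g by exact: concave_shift.
have mem_cover i : [|| i == s, i \in S0 | i \in S1].
  by have := finset.in_setT i; rewrite -cover !inE.
have S01 i : i \in S0 -> (i \in S1) = false.
  by move=> i0; exact: disjointFr disjoint_S0S1 i0.
have sum_split (F : 'I_n -> R) :
    \sum_i F i = F s + (\sum_(i in S0) F i + \sum_(i in S1) F i).
  rewrite (bigD1 s) //= (bigID (mem S0)) /=; congr (_ + (_ + _)).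
    apply: eq_bigl => i; case: eqP => //= ->.
    by rewrite (negPf s_notin_S0).
  apply: eq_bigl => i; have := mem_cover i; case: eqP => [->|_] /=.
    by rewrite (negPf s_notin_S1).
  by have := S01 i; case: (i \in S0) => [/(_ isT) ->|_ /= ->].
(* [d i] is the direction from [v] into the box along coordinate [i]; [d s = 0] lets [s] be treated
   like the other indices. *)
pose d i : R := if i == s then 0 else if i \in S1 then -1 else 1.
pose v : 'rV[R]_n := \row_i if i \in S1 then (mu 0 i)%:~R else 0.
pose u : 'rV[R]_n := \row_i if i == s then rho k else d i * Z (d i * a 0 i).
pose b := g (k%:~R * a 0 s) - rho k * k%:~R + \sum_(i in S1) Z (- a 0 i) * (mu 0 i)%:~R.
have ds : d s = 0 by rewrite /d eqxx.
have vs : v 0 s = 0 by rewrite mxE (negPf s_notin_S1).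
have us : u 0 s = rho k by rewrite mxE eqxx.
have S0s i : i \in S0 -> i == s = false.
  by apply: contraTF => /eqP ->.
have S1s i : i \in S1 -> i == s = false.
  by apply: contraTF => /eqP ->.
have d0 i : i \in S0 -> d i = 1 by move=> i0; rewrite /d S0s // S01.
have d1 i : i \in S1 -> d i = -1 by move=> i1; rewrite /d S1s // i1.
have u0 i : i \in S0 -> u 0 i = Z (a 0 i).
  by move=> i0; rewrite mxE S0s // d0 // !mul1r.
have u1 i : i \in S1 -> u 0 i = - Z (- a 0 i).
  by move=> i1; rewrite mxE S1s // d1 // !mulN1r.
have dotv (y : 'rV[R]_n) : dot y v = \sum_(i in S1) y 0 i * (mu 0 i)%:~R.
  rewrite /dot sum_split vs mulr0 add0r big1 ?add0r => [|i i0].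
    by apply: eq_bigr => i i1; rewrite mxE i1.
  by rewrite mxE S01 // mulr0.
have rhsE (x : 'rV[R]_n) : dot u x + b = \sum_(i in S0) Z (a 0 i) * x 0 i
    + \sum_(i in S1) Z (- a 0 i) * ((mu 0 i)%:~R - x 0 i)
    + rho k * (x 0 s - k%:~R) + g (k%:~R * a 0 s).
  under [\sum_(i in S1) _]eq_bigr => i _ do rewrite mulrBr.
  rewrite sumrB /dot sum_split us /b.
  under eq_bigr => i i0 do rewrite u0 //.
  under [\sum_(i in S1) u 0 i * _]eq_bigr => i i1 do rewrite u1 // mulNr.
  rewrite sumrN; ring.
rewrite [X in facet_defining _ _ X](_ : _ = fun p : R^o * 'rV[R]_n => dot u p.2 + b);
  last by apply/funext => p; rewrite rhsE.
have Z0 : Z 0 = 0 by exact: Zmax0.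
have ud i : u 0 i * d i = Z (d i * a 0 i).
  rewrite mxE /d; case: eqP => [_|_]; first by rewrite mulr0 mul0r Z0.
  by case: ifP => _; rewrite ?mulN1r ?mul1r ?mulr1 ?mulrN1 ?opprK.
(* At [s] the maximum [Z 0 = 0] is attained at both [k - 1] and [k]; [k - 1] is prescribed here and
   [k] is kept for the extra point [q ord0]. *)
have tP i : exists t : int, [/\ 0 <= t <= mu 0 s, i = s -> t = k - 1 &
    Z (d i * a 0 i) = g (d i * a 0 i + a 0 s * t%:~R)
      - rho k * (t - k)%:~R - g (k%:~R * a 0 s)].
  have [->|i_s] := eqVneq i s.
    exists (k - 1); split=> //; first by lia.
    rewrite ds mul0r Z0 add0r [a 0 s * _]mulrC.
    rewrite /rho /rho_of !rmorphB /=; ring.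
  have ms_gt0 : 0 < mu 0 s by have := mu_ge1 s; lia.
  (* [hS0] and [hS1] each give one end of the interval in [Zmax_attained]; the signs of [ka0] and
     [kma0] give the other. *)
  have ka0 : 0 <= k%:~R * a 0 s.
    by rewrite mulr_ge0 ?ler0z ?ltW //; lia.
  have kma0 : (k - mu 0 s - 1)%:~R * a 0 s <= 0.
    by rewrite pmulr_lle0 // lerz0; lia.
  have [|t tm tE] := Zmax_attained (k := k) cg as_gt0 (d i * a 0 i) _ ms_gt0.
    have := mem_cover i; rewrite (negPf i_s) /= => /orP[i0|i1].
      by rewrite d0 // mul1r; have := hS0 _ i0; lra.
    by rewrite d1 // mulN1r; have := hS1 _ i1; lra.
  by exists t; split=> // /eqP; rewrite (negPf i_s).
have [t tE] := choice tP.
pose pt i (x : int) : 'rV[R]_n := v + d i *: delta_mx 0 i + x%:~R *: delta_mx 0 s.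
have ptE i x j : pt i x 0 j = v 0 j + d i * (j == i)%:R + x%:~R * (j == s)%:R.
  by rewrite !mxE eqxx.
(* At [pt i x] the value of [f] is [g (d i * a 0 i + a 0 s * x)], so tightness there is attainment
   of the maximum at [x]. Quantifying over [w] covers the lower point as well. *)
have ptX i (x : int) : 0 <= x <= mu 0 s ->
    Z (d i * a 0 i) = g (d i * a 0 i + a 0 s * x%:~R)
      - rho k * (x - k)%:~R - g (k%:~R * a 0 s) ->
    dot u (pt i x) + b = f (dot a (pt i x)) /\
    forall w, w <= f (dot a (pt i x)) -> calX f a mu (w, pt i x).
  move=> xm ZE; split.
    have -> : dot a (pt i x) = d i * a 0 i + a 0 s * x%:~R
        + \sum_(j in S1) (mu 0 j)%:~R * a 0 j.
      rewrite !dotD !dotZ !dot_delta dotv.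
      under eq_bigr => j _ do rewrite mulrC.
      ring.
    rewrite -/(g_of f a mu S1 _) -/g.
    rewrite !dotD !dotZ !dot_delta us dotv [d i * u _ _]mulrC ud ZE /b.
    under eq_bigr => j j1 do rewrite u1 // mulNr.
    rewrite sumrN rmorphB /=; ring.
  move=> w wf; split=> //= j.
    rewrite !mxE /d; repeat case: ifP => _; rewrite /=;
      by rewrite ?(rpredD, rpredM, rpredN, rpred_nat, intr_int, rpred0, rpred1).
  (* [mu >= 1] keeps a unit step from [v] inside the box. *)
  have muR l : 1 <= (mu 0 l)%:~R :> R by rewrite ler1z.
  have xR : 0 <= (x%:~R : R) <= (mu 0 s)%:~R by rewrite ler0z ler_int.
  rewrite !mxE eqxx /=; have := mem_cover j; case: eqP => [->|/eqP js] /=.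
    rewrite (negPf s_notin_S1) mulr1 add0r => _.
    by case: (eqVneq s i) => [<-|_]; rewrite ?ds ?mul0r ?mulr0 add0r.
  rewrite mulr0 addr0 => /orP[jS|jS].
    rewrite S01 // add0r; case: eqP => [<-|_].
      by rewrite d0 // mulr1 ler01 muR.
    by rewrite mulr0 lexx (le_trans ler01).
  rewrite jS; case: eqP => [<-|_].
    by rewrite d1 // mulr1; have := muR j; lra.
  by rewrite mulr0 addr0 lexx (le_trans ler01).
have kE : Z (d s * a 0 s) = g (d s * a 0 s + a 0 s * k%:~R)
      - rho k * (k - k)%:~R - g (k%:~R * a 0 s).
  by rewrite ds mul0r Z0 add0r subrr mulr0 mulrC subr0 subrr.
have km : 0 <= k <= mu 0 s by lia.
pose q (i : 'I_n.+1) := if unlift ord0 i is Some j then pt j (t j) else pt s k.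
have qX i : dot u (q i) + b = f (dot a (q i)) /\
    forall w, w <= f (dot a (q i)) -> calX f a mu (w, q i).
  rewrite /q; case: unlift => [j|]; last exact: ptX.
  by have [? _ ?] := tE j; exact: ptX.
apply: (facet_of_tight_points _ _ _ (dot u (q ord0) + b - 1) q).
- move=> p [pint pf pmu]; apply: le_trans pf _.
  (* [m i] is the distance of coordinate [i] from [v] for [i] in S0 or S1; [Zmax_sum] needs it as a
     natural number. *)
  have mP i : exists m : nat, (i \in S0 -> p.2 0 i = m%:R) /\
      (i \in S1 -> (mu 0 i)%:~R - p.2 0 i = m%:R).
    have /andP[p0 pm] := pmu i.
    have [i1|i1] := boolP (i \in S1).
      have /natrP[m mE] : (mu 0 i)%:~R - p.2 0 i \is a Num.nat.
        by rewrite natrEint rpredB ?intr_int ?subr_ge0.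
      by exists m; split=> // /S01; rewrite i1.
    have /natrP[m mE] : p.2 0 i \is a Num.nat by rewrite natrEint p0 pint.
    by exists m.
  have [m mE] := choice mP.
  have /intrP[x xE] := pint s.
  pose D := \sum_(i in S0) a 0 i * (m i)%:R + \sum_(i in S1) - a 0 i * (m i)%:R.
  have -> : f (\sum_(i < n) a 0 i * p.2 0 i) = g (D + a 0 s * x%:~R).
    rewrite /g /g_of /D; congr f; rewrite sum_split xE.
    under eq_bigr => i i0 do rewrite (mE i).1 //.
    under [X in _ + (_ + X)]eq_bigr => i i1.
      rewrite (_ : p.2 0 i = (mu 0 i)%:~R - (m i)%:R);
        last by rewrite -(mE i).2 // subKr.
      rewrite mulrBr -mulNr [a 0 i * (mu 0 i)%:~R]mulrC; over.
    rewrite big_split /=; ring.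
  (* [g (D + a_s x)] is at most [Z D + rho_s (x - k) + g (k a_s)], and subadditivity splits [Z D]
     into the sums over S0 and S1. *)
  have := Zmax_ge (k := k) cg as_gt0 D x.
  have := Zmax_subadditive (k := k) cg as_gt0
    (\sum_(i in S0) a 0 i * (m i)%:R) (\sum_(i in S1) - a 0 i * (m i)%:R).
  have := Zmax_sum (k := k) cg as_gt0 _ (mem S0) (fun i => a 0 i) m.
  have := Zmax_sum (k := k) cg as_gt0 _ (mem S1) (fun i => - a 0 i) m.
  rewrite -/D -/rho -/Z rhsE xE rmorphB /= => le1 le0 leD leg.
  under eq_bigr => i i0 do rewrite (mE i).1 //.
  under [\sum_(i in S1) Z _ * (_ - _)]eq_bigr => i i1 do rewrite (mE i).2 //.
  rewrite -/Z in le1 le0 leD leg *.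
  lra.
- move=> c; rewrite !big_ord_recl /q unlift_none.
  under [X in _ -> _ + X = 0 -> _]eq_bigr => i _ do rewrite liftK.
  set c0 := c ord0; pose e i := c (lift ord0 i); rewrite -/(e _) => ec ept.
  have coord j : c0 * pt s k 0 j + \sum_i e i * pt i (t i) 0 j = 0.
    have := congr1 (fun y : 'rV_n => y 0 j) ept; rewrite /= mxE summxE [RHS]mxE => pE.
    rewrite -[RHS]pE; congr (_ + _); first by rewrite [RHS]mxE.
    by apply: eq_bigr => i _; rewrite [RHS]mxE.
  (* Only [pt j] differs from [v] in coordinate [j]; as the weights sum to zero, what remains is
     [e j * d j = 0]. *)
  have e0 j : j != s -> e j = 0.
    move=> js; have := coord j.
    under eq_bigr => i _ do
      rewrite ptE (negPf js) mulr0 addr0 mulrDr.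
    rewrite ptE (negPf js) ds mul0r mulr0 !addr0 big_split /= -mulr_suml addrA -mulrDl.
    rewrite ec mul0r add0r (bigD1 j) //= eqxx mulr1 big1 ?addr0; last first.
      by move=> i /negPf ij; rewrite eq_sym ij !mulr0.
    move/eqP; rewrite mulf_eq0 => /orP[/eqP //|].
    rewrite /d (negPf js); case: ifP => _; rewrite ?oppr_eq0 oner_eq0 //.
  have sum_e (F : 'I_n -> R) : \sum_i e i * F i = e s * F s.
    by rewrite (bigD1 s) //= big1 ?addr0 // => j /e0 ->; rewrite mul0r.
  have ec' : c0 + e s = 0.
    rewrite -[RHS]ec; congr (_ + _).
    by have := sum_e (fun=> 1); rewrite mulr1; under eq_bigr do rewrite mulr1.
  (* Only [v + k e_s] and [v + (k - 1) e_s] are left, with opposite weights; their [s]-coordinates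
     differ by one. *)
  have es0 : e s = 0.
    have := coord s; rewrite sum_e !ptE !eqxx ds vs !mul0r !add0r !mulr1.
    have [_ -> //] := tE s; rewrite rmorphB /=.
    have -> : c0 = - e s by lra.
    lra.
  move=> i; case: (unliftP ord0 i) => [j|] ->; last by rewrite -/c0; lra.
  by rewrite -/(e j); have [->|/e0] := eqVneq j s.
- by move=> i; apply: (qX i).2; rewrite (qX i).1.
- by apply: (qX _).2; rewrite (qX _).1; lra.
- lra.
Qed.
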